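(* Let $\mathcal{T},\mathcal{Z}\in\mathbb{R}^{\tilde n\times \tilde M}$, let $r := \operatorname{rank}(\mathcal{T})$, and let $\mathcal{T} = V_1\Sigma_1 W_1^{\mathsf T}$ be the skinny singular value decomposition of $\mathcal{T}$, where $V_1\in\mathbb{R}^{\tilde n\times r}$ and $W_1\in\mathbb{R}^{\tilde M\times r}$ have orthonormal columns and $\Sigma_1\in\mathbb{R}^{r\times r}$ is the nonsingular diagonal matrix of the nonzero singular values. Let $W_2$ be such that $\begin{bmatrix} W_1 & W_2\end{bmatrix}\in\mathbb{R}^{\tilde M\times\tilde M}$ is orthogonal. Define $$\widetilde{\mathcal{Z}}_1 := \Sigma_1 V_1^{\mathsf T}\mathcal{Z}W_1,\qquad \widetilde{\mathcal{Z}}_2 := \Sigma_1 V_1^{\mathsf T}\mathcal{Z}W_2,$$ and $$\widetilde{\mathcal{J}}^\star := V_1\Sigma_1^{-1}\operatorname{skew}(\widetilde{\mathcal{Z}}_1)\Sigma_1^{-1}V_1^{\mathsf T},\qquad \widetilde{\mathcal{R}}^\star := V_1\Sigma_1^{-1}\mathcal{P}_{\succeq}(-\widetilde{\mathcal{Z}}_1)\Sigma_1^{-1}V_1^{\mathsf T}.$$ Then $\widetilde{\mathcal{J}}^\star$ and $\widetilde{\mathcal{R}}^\star$ are the unique minimum-norm minimizers of the optimization problem $$\min \left\|\mathcal{T}^{\mathsf T}\bigl(\mathcal{Z} - (\widetilde{\mathcal{J}}-\widetilde{\mathcal{R}})\mathcal{T}\bigr)\right\|_{\mathrm F}\quad\text{such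 that } \widetilde{\mathcal{J}}=-\widetilde{\mathcal{J}}^{\mathsf T}\in\mathbb{R}^{\tilde n\times\tilde n}\text{ and }\widetilde{\mathcal{R}}\in\mathcal{S}^{\tilde n}_{\succeq},$$ and $$\left\|\mathcal{T}^{\mathsf T}\mathcal{Z}-\mathcal{T}^{\mathsf T}(\widetilde{\mathcal{J}}^\star-\widetilde{\mathcal{R}}^\star)\mathcal{T}\right\|_{\mathrm F}^2 = \left\|\widetilde{\mathcal{Z}}_2\right\|_{\mathrm F}^2+\left\|\Lambda_+\right\|_{\mathrm F}^2,$$ where $\Lambda_+$ is the diagonal matrix containing the positive eigenvalues (with multiplicity) of $\operatorname{sym}(\widetilde{\mathcal{Z}}_1)$.
   Context: All matrices are real and $\|\cdot\|_{\mathrm F}$ is the Frobenius norm. $\mathcal{S}^{n}_{\succeq}$ denotes the set of symmetric positive semidefinite matrices in $\mathbb{R}^{n\times n}$. For a square matrix $A$, $\operatorname{sym}(A)=\tfrac12(A+A^{\mathsf T})$ and $\operatorname{skew}(A)=\tfrac12(A-A^{\mathsf T})$. For $A\in\mathbb{R}^{n\times n}$, $\mathcal{P}_{\succeq}(A)$ denotes the projection onto $\mathcal{S}^n_{\succeq}$, given by $\mathcal{P}_{\succeq}(A)=\Xi\operatorname{diag}(\Lambda_+,0,0)\Xi^{\mathsf T}$, where $\operatorname{sym}(A)=\Xi\operatorname{diag}(\Lambda_+,\Lambda_-,0)\Xi^{\mathsf T}$ is an orthogonal eigendecomposition of the symmetric part of $A$, with $\Lambda_+$ and $\Lambda_-$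 the diagonal matrices of positive and negative eigenvalues of $\operatorname{sym}(A)$, respectively. ''Minimum-norm minimizers'' means: $(\widetilde{\mathcal{J}}^\star,\widetilde{\mathcal{R}}^\star)$ is feasible and attains the minimum, and every minimizing feasible pair $(\widetilde{\mathcal{J}},\widetilde{\mathcal{R}})$ satisfies $\|\widetilde{\mathcal{J}}\|_{\mathrm F}\ge\|\widetilde{\mathcal{J}}^\star\|_{\mathrm F}$ and $\|\widetilde{\mathcal{R}}\|_{\mathrm F}\ge\|\widetilde{\mathcal{R}}^\star\|_{\mathrm F}$; ''unique'' means that it is the only minimizing pair with this property. *)

(* Defs.v *)
From mathcomp Require Import all_boot all_order all_algebra.
From mathcomp Require Import boolp classical_sets reals.

Set Implicit Arguments.
Unset Strict Implicit.
Unset Printing Implicit Defensive.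

Import Order.TTheory GRing.Theory Num.Theory.
Local Open Scope ring_scope.

Definition frob (R : realType) m n (A : 'M[R]_(m, n)) : R :=
  Num.sqrt (\sum_(i < m) \sum_(j < n) A i j ^+ 2).

Definition symp (R : realType) n (A : 'M[R]_n) : 'M[R]_n :=
  2^-1 *: (A + A^T).

Definition skewp (R : realType) n (A : 'M[R]_n) : 'M[R]_n :=
  2^-1 *: (A - A^T).

Definition psd (R : realType) n (A : 'M[R]_n) : Prop :=
  A^T = A /\ forall x : 'cV[R]_n, 0 <= (x^T *m A *m x) 0 0.

Definition orthonormal_cols (R : realType) m n (Q : 'M[R]_(m, n)) : Prop :=
  Q^T *m Q = 1%:M.

(* The two dimensions may differ syntactically, so that block matrices such as
   [row_mx W1 W2] need no cast; the two equations force m = n. *)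
Definition orthogonal_mx (R : realType) m n (Q : 'M[R]_(m, n)) : Prop :=
  Q^T *m Q = 1%:M /\ Q *m Q^T = 1%:M.

Definition eigendecomposition (R : realType) n (A : 'M[R]_n) p q z
    (Xi : 'M[R]_(n, p + (q + z))) (lp : 'rV[R]_p) (lm : 'rV[R]_q) : Prop :=
  [/\ orthogonal_mx Xi,
      forall i, 0 < lp 0 i,
      forall i, lm 0 i < 0 &
      A = Xi *m diag_mx (row_mx lp (row_mx lm 0)) *m Xi^T].

Definition psd_part_of (R : realType) n (A P : 'M[R]_n) : Prop :=
  exists p q z (Xi : 'M[R]_(n, p + (q + z))) (lp : 'rV[R]_p) (lm : 'rV[R]_q),
    eigendecomposition (symp A) Xi lp lm /\
    P = Xi *m diag_mx (row_mx lp (row_mx 0 0)) *m Xi^T.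

(* By the spectral theorem such a matrix exists for every A, so the default
   value 0 of [xget] is never used; it does not depend on the decomposition. *)
Definition psd_proj (R : realType) n (A : 'M[R]_n) : 'M[R]_n :=
  xget 0 [set P | psd_part_of A P]%classic.

(* Real eigenvalues with algebraic multiplicity, in an unspecified order.
   Meaningful when the characteristic polynomial splits over R, as it does for
   symmetric A. *)
Definition eigenvalues (R : realType) n (A : 'M[R]_n) : seq R :=
  xget [::] [set s : seq R | char_poly A = \prod_(a <- s) ('X - a%:P)]%classic.

Definition pos_eigenvalues (R : realType) n (A : 'M[R]_n) : seq R :=
  [seq a <- eigenvalues A | 0 < a].

Definition Lambda_pos (R : realType) n (A : 'M[R]_n) :
    'M[R]_(size (pos_eigenvalues A)) :=
  diag_mx (\row_(i < size (pos_eigenvalues A)) (pos_eigenvalues A)`_i).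

(* The singular values need not be sorted. *)
Definition skinny_svd (R : realType) n M (T : 'M[R]_(n, M))
    (V1 : 'M[R]_(n, \rank T)) (sigma : 'rV[R]_(\rank T))
    (W1 : 'M[R]_(M, \rank T)) : Prop :=
  [/\ orthonormal_cols V1,
      orthonormal_cols W1,
      forall i, 0 < sigma 0 i &
      T = V1 *m diag_mx sigma *m W1^T].

Definition feasible (R : realType) n (J S : 'M[R]_n) : Prop :=
  J = - J^T /\ psd S.

Definition objective (R : realType) n M (T Z : 'M[R]_(n, M))
    (J S : 'M[R]_n) : R :=
  frob (T^T *m (Z - (J - S) *m T)).

Definition minimizer (R : realType) n M (T Z : 'M[R]_(n, M))
    (J S : 'M[R]_n) : Prop :=
  feasible J S /\
  forall J' S' : 'M[R]_n, feasible J' S' ->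
    objective T Z J S <= objective T Z J' S'.

Definition min_norm_minimizer (R : realType) n M (T Z : 'M[R]_(n, M))
    (J S : 'M[R]_n) : Prop :=
  minimizer T Z J S /\
  forall J' S' : 'M[R]_n, minimizer T Z J' S' ->
    frob J <= frob J' /\ frob S <= frob S'.

(* Main.v *)
(** Multiplying the residual by the orthogonal matrices of the singular value
    decomposition turns the squared objective into the constant [frob Z2 ^+ 2]
    plus [frob (S' - symp (- Z1)) ^+ 2 + frob (J' - skewp Z1) ^+ 2], where
    [X' = Sigma1 V1^T X V1 Sigma1]: symmetric and skew-symmetric matrices are
    orthogonal.  The two terms decouple; the first is minimised over the psd
    cone exactly at the projection of [- Z1], the second exactly at [skewp Z1].
    The minimisers are therefore the feasible pairs with prescribed compressions
    [V1^T J V1] and [V1^T S V1], and a matrix with a prescribed compression [K]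
    has least norm exactly when it equals [V1 K V1^T].

    The existence of the eigendecomposition defining the projection is the real
    spectral theorem, obtained by deflation from a real eigenvalue, itself found
    among the complex roots of the characteristic polynomial. *)
Require Import Defs.
From mathcomp Require Import all_boot all_order all_algebra.
From mathcomp Require Import classical_sets reals complex ring lra.

Set Implicit Arguments.
Unset Strict Implicit.
Unset Printing Implicit Defensive.

Import Order.TTheory GRing.Theory Num.Theory.
Local Open Scope ring_scope.

(** * The real spectral theorem *)

Lemma symmetric_eigenvalue (R : rcfType) n (A : 'M[R]_n.+1) :
  A^T = A -> exists a, eigenvalue A a.
Proof.
move=> symA; pose AC := map_mx (real_complex R) A.
have [a] := eigenvalue_closed AC (ltn0Sn n).
have aE := eigenvalue_root_char AC a; move=> /[dup] eig_a.
case/eigenvalueP=> v vA v0.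
have AC_herm : map_mx Num.conj AC^T = AC.
  by apply/matrixP=> i j; rewrite !mxE -[in LHS]symA mxE; exact: conjc_real.
have dv : (v *m map_mx Num.conj v^T) 0 0 != 0.
  by rewrite -dotmxE; apply: lt0r_neq0; exact: dotmx_is_dotmx.
(* Since [AC] is Hermitian, evaluating [v AC v^*] with [AC] acting on either factor yields both [a]
   and its conjugate times the nonzero [v v^*]. *)
have a_real : a \is Num.real.
  rewrite CrealE eq_sym; apply/eqP/(mulIf dv).
  transitivity ((v *m map_mx Num.conj (v *m AC)^T) 0 0).
    by rewrite trmx_mul map_mxM AC_herm mulmxA vA -scalemxAl [RHS]mxE.
  by rewrite vA linearZ map_mxZ -scalemxAr [LHS]mxE.
have aRe : a = real_complex R (complex.Re a) by rewrite RRe_real.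
exists (complex.Re a); rewrite eigenvalue_root_char.
by move: eig_a; rewrite aE aRe -map_char_poly fmorph_root.
Qed.

Lemma mx11_trace (R : pzRingType) (A : 'M[R]_1) : A = (\tr A)%:M.
Proof. by rewrite {1}[A]mx11_scalar /mxtrace big_ord1. Qed.

Lemma mxtrace_tr_mul (R : pzRingType) m n (A : 'M[R]_(m, n)) :
  \tr (A^T *m A) = \sum_(i < m) \sum_(j < n) A i j ^+ 2.
Proof.
rewrite exchange_big; apply: eq_bigr => j _; rewrite mxE.
by apply: eq_bigr => i _; rewrite mxE expr2.
Qed.

Lemma mxtrace_tr_mul_ge0 (R : realDomainType) m n (A : 'M[R]_(m, n)) :
  0 <= \tr (A^T *m A).
Proof.
by rewrite mxtrace_tr_mul !sumr_ge0 // => i _; apply: sumr_ge0 => j _; rewrite sqr_ge0.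
Qed.

Lemma mxtrace_tr_mul_eq0 (R : realDomainType) m n (A : 'M[R]_(m, n)) :
  \tr (A^T *m A) = 0 -> A = 0.
Proof.
rewrite mxtrace_tr_mul => /psumr_eq0P A0; apply/matrixP => i j; rewrite mxE.
have /psumr_eq0P Ai0 : \sum_(k < n) A i k ^+ 2 = 0.
  by apply: A0 => // k _; apply: sumr_ge0 => l _; rewrite sqr_ge0.
by apply/eqP; rewrite -sqrf_eq0; apply/eqP/Ai0 => // k _; rewrite sqr_ge0.
Qed.

(* The witness is the Householder reflection exchanging [v] and the first
   basis vector. *)
Lemma orthogonal_extension (R : realFieldType) n (v : 'cV[R]_n.+1) :
  v^T *m v = 1%:M ->
  exists Q : 'M[R]_n.+1, Q^T *m Q = 1%:M /\ Q *m delta_mx 0 0 = v.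
Proof.
move=> v1; pose e : 'cV[R]_n.+1 := delta_mx 0 0.
have [/eqP|v_e] := boolP (v == e).
  by move=> ->; exists 1%:M; rewrite trmx1 mulmx1 mul1mx.
pose u := v - e; pose s := \tr (u^T *m u).
have s0 : s != 0.
  by apply: contra v_e => /eqP/mxtrace_tr_mul_eq0/eqP; rewrite subr_eq0.
have uu : u^T *m u = s%:M by rewrite [LHS]mx11_trace.
have ee : e^T *m e = 1%:M.
  by rewrite trmx_delta mul_delta_mx; apply/matrixP=> i j; rewrite !ord1 !mxE.
have ve : v^T *m e = e^T *m v.
  by rewrite -[LHS]trmxK trmx_mul trmxK [LHS]mx11_trace mxtrace_tr -mx11_trace.
(* Both [v] and [e] are unit vectors, so [|v - e|^2 = 2 - 2 <v, e> = -2 <v - e, e>]. *)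
have ue : u^T *m e = - (s / 2)%:M.
  have : u^T *m u = - 2 *: (u^T *m e).
    have -> : u^T = v^T - e^T by rewrite /u raddfB.
    rewrite /u !(mulmxBl, mulmxBr) v1 ee ve; set w := e^T *m v.
    by apply/matrixP => i j; rewrite !ord1 !mxE; ring.
  rewrite uu => /(congr1 (fun A => (- 2)^-1 *: A)).
  rewrite scalerA mulVf ?oppr_eq0 ?pnatr_eq0 // scale1r => <-.
  by rewrite invrN scaleNr -mul_scalar_mx -scalar_mxM mulrC.
exists (1%:M - (2 / s) *: (u *m u^T)); split; last first.
  rewrite -/e mulmxBl mul1mx -scalemxAl -mulmxA ue mulmxN mul_mx_scalar.
  rewrite scalerN opprK scalerA (_ : _ * _ = 1) ?scale1r; last by field.
  by rewrite addrC subrK.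
rewrite [X in X *m _]raddfB /= linearZ /= trmx1 trmx_mul trmxK.
rewrite mulmxBl !mul1mx mulmxBr mulmx1.
rewrite -!scalemxAl -!scalemxAr mulmxA -(mulmxA u) uu mul_mx_scalar -scalemxAl.
rewrite !scalerA -scalerBl -addrA -opprD -scalerDl.
by rewrite (_ : 2 / s + _ = 0) ?scale0r ?subr0 //; field.
Qed.

(** Conjugating by an orthogonal matrix that sends the first basis vector to a unit eigenvector
    clears the rest of the first column; symmetry clears the first row, and induction diagonalises
    the remaining block. *)
Lemma symmetric_spectral (R : rcfType) n (A : 'M[R]_n) : A^T = A ->
  exists (Q : 'M[R]_n) (d : 'rV[R]_n),
    Q^T *m Q = 1%:M /\ A = Q *m diag_mx d *m Q^T.
Proof.
elim: n A => [A _|n IHn A symA].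
  by exists 1%:M, 0; rewrite trmx1 mulmx1; split=> //; rewrite !flatmx0.
have [a /eigenvalueP[w wA w0]] := symmetric_eigenvalue symA.
pose c := \tr (w^T^T *m w^T).
have c_gt0 : 0 < c.
  rewrite lt_def mxtrace_tr_mul_ge0 andbT.
  apply: contra w0 => /eqP/mxtrace_tr_mul_eq0 w0.
  by rewrite -(trmxK w) w0 trmx0.
pose v := (Num.sqrt c)^-1 *: w^T.
have v1 : v^T *m v = 1%:M.
  rewrite /v [X in X *m _]linearZ /= -scalemxAl -scalemxAr scalerA [_ *m _]mx11_trace.
  rewrite -/c -mul_scalar_mx -scalar_mxM -expr2 exprVn sqr_sqrtr ?ltW //.
  by rewrite mulVf // gt_eqF.
(* Eigenvectors in [eigenvalueP] are rows; symmetry of [A] makes the transpose a column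
   eigenvector. *)
have Av : A *m v = a *: v.
  rewrite /v -scalemxAr -{1}symA -trmx_mul wA linearZ /= !scalerA.
  by rewrite mulrC.
have [Q [QQ Qe]] := orthogonal_extension v1.
have QQ' := mulmx1C QQ.
(* An opaque [B] typed at [1 + n] admits the block operations. *)
have [B BD] : exists B : 'M[R]_(1 + n), B = Q^T *m A *m Q by exists (Q^T *m A *m Q).
have symB : B^T = B by rewrite BD !trmx_mul trmxK symA mulmxA.
have Be : (B : 'M_n.+1) *m delta_mx 0 0 = a *: (delta_mx 0 0 : 'cV_n.+1).
  by rewrite BD -!mulmxA Qe Av -scalemxAr -Qe mulmxA QQ mul1mx.
have B0 i : B i 0 = a * (i == 0)%:R.
  have := congr1 (fun C : 'cV_n.+1 => C i 0) Be.
  by rewrite -colE !mxE eqxx andbT.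
have dlB : dlsubmx B = 0.
  apply/matrixP=> i j; rewrite !mxE !ord1 (_ : lshift n 0 = 0); last exact/val_inj.
  by rewrite B0 mulr0.
have urB : ursubmx B = 0.
  by rewrite -[B]symB -trmx_dlsub dlB trmx0.
have [P [d [PP drB]]] := IHn (drsubmx B) (etrans (trmx_drsub B) (congr1 _ symB)).
pose F : 'M[R]_(1 + n) := block_mx 1%:M 0 0 P.
have FF : F^T *m F = 1%:M.
  rewrite /F tr_block_mx mulmx_block !trmx0 !(mulmx0, mul0mx) trmx1 mulmx1.
  by rewrite !(addr0, add0r) PP -scalar_mx_block.
have BE : B = F *m diag_mx (row_mx (row 0 (ulsubmx B)) d) *m F^T.
  rewrite -{1}[B]submxK dlB urB drB /F tr_block_mx diag_mx_row !mulmx_block.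
  rewrite !trmx0 !(mulmx0, mul0mx) trmx1 mulmx1 mul1mx !(addr0, add0r).
  congr (block_mx _ _ _ _); rewrite ?mul0mx //; apply/matrixP=> i j.
  by rewrite !ord1 !mxE eqxx.
exists (Q *m F), (row_mx (row 0 (ulsubmx B)) d); split.
  by rewrite trmx_mul mulmxA -(mulmxA _ Q^T) QQ mulmx1.
transitivity (Q *m B *m Q^T).
  by rewrite BD !mulmxA QQ' mul1mx -mulmxA QQ' mulmx1.
by rewrite [in LHS]BE trmx_mul !mulmxA.
Qed.

(** * Eigendecompositions sorted by sign *)

Lemma mulmx1C_cast (R : comPzRingType) m n (A : 'M[R]_(m, n)) (B : 'M[R]_(n, m)) :
  m = n -> A *m B = 1%:M -> B *m A = 1%:M.
Proof. by move=> e; case: n / e A B => A B; apply: mulmx1C. Qed.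

Lemma mulmx_diag_trE (R : pzSemiRingType) m n (A : 'M[R]_(m, n)) (d : 'rV[R]_n) i j :
  (A *m diag_mx d *m A^T) i j = \sum_k A i k * d 0 k * A j k.
Proof. by rewrite mul_mx_diag mxE; apply: eq_bigr => k _; rewrite !mxE. Qed.

(** The columns of a spectral basis are regrouped by the sign of their eigenvalue; the block sizes
    are the cardinalities of the three sign classes. *)
Lemma eigendecomposition_exists (R : realType) n (A : 'M[R]_n) : A^T = A ->
  exists p q z (Xi : 'M[R]_(n, p + (q + z))) (lp : 'rV[R]_p) (lm : 'rV[R]_q),
    eigendecomposition A Xi lp lm.
Proof.
move=> /symmetric_spectral[Q [d [QQ AE]]].
pose P := [pred i | 0 < d 0 i]; pose N := [pred i | d 0 i < 0].
pose O := [pred i | d 0 i == 0].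
pose Xi : 'M_(n, #|P| + (#|N| + #|O|)) :=
  row_mx (\matrix_(i, k) Q i (enum_val k))
    (row_mx (\matrix_(i, k) Q i (enum_val k)) (\matrix_(i, k) Q i (enum_val k))).
have split_sum (F : 'I_n -> R) : \sum_k F k = 
    \sum_(k < #|P|) F (enum_val k) +
    (\sum_(k < #|N|) F (enum_val k) + \sum_(k < #|O|) F (enum_val k)).
  rewrite -!big_enum_val /= (bigID P) /=; congr (_ + _).
  rewrite (bigID N) /=; congr (_ + _); apply: eq_bigl => k; rewrite !inE.
    by case: ltrgtP.
  by case: ltrgtP.
exists #|P|, #|N|, #|O|, Xi, (\row_k d 0 (enum_val k)), (\row_k d 0 (enum_val k)).
have XX : Xi *m Xi^T = 1%:M.
  rewrite -(mulmx1C QQ) /Xi !tr_row_mx !mul_row_col; apply/matrixP => i j.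
  rewrite !mxE split_sum; congr (_ + (_ + _)).
  - by apply: eq_bigr => k _; rewrite !mxE.
  - by apply: eq_bigr => k _; rewrite !mxE.
  - by apply: eq_bigr => k _; rewrite !mxE.
(* The one-sided inverse [XX] becomes two-sided once [Xi] is known to be square. *)
have dim : (n = #|P| + (#|N| + #|O|))%N.
  rewrite -[LHS]card_ord -(cardC P); congr (_ + _)%N.
  rewrite -(cardID N); congr (_ + _)%N; apply: eq_card => k; rewrite !inE.
    by case: ltrgtP.
  by case: ltrgtP.
split.
- by split=> //; apply: mulmx1C_cast XX.
- by move=> i; rewrite mxE; have := enum_valP i.
- by move=> i; rewrite mxE; have := enum_valP i.
apply/matrixP => i j; rewrite AE !mulmx_diag_trE split_sum !big_split_ord /=.
congr (_ + (_ + _)); apply: eq_bigr => k _; rewrite /Xi !(row_mxEl, row_mxEr) !mxE //.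
by have /eqP -> := enum_valP k.
Qed.

(** * The Frobenius norm and its isometries *)

Lemma frob_ge0 (R : realType) m n (A : 'M[R]_(m, n)) : 0 <= frob A.
Proof. exact: sqrtr_ge0. Qed.

Lemma frob_sqr (R : realType) m n (A : 'M[R]_(m, n)) :
  frob A ^+ 2 = \tr (A^T *m A).
Proof. by rewrite /frob -mxtrace_tr_mul sqr_sqrtr // mxtrace_tr_mul_ge0. Qed.

Lemma ler_frob (R : realType) m n m' n' (A : 'M[R]_(m, n)) (B : 'M[R]_(m', n')) :
  (frob A <= frob B) = (frob A ^+ 2 <= frob B ^+ 2).
Proof. by rewrite ler_sqr // nnegrE frob_ge0. Qed.

Lemma frob_sqr_eq0 (R : realType) m n (A : 'M[R]_(m, n)) :
  frob A ^+ 2 = 0 -> A = 0.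
Proof. by rewrite frob_sqr; exact: mxtrace_tr_mul_eq0. Qed.

Lemma frob0 (R : realType) m n : frob (0 : 'M[R]_(m, n)) = 0.
Proof. by apply/eqP; rewrite -sqrf_eq0 frob_sqr mulmx0 mxtrace0. Qed.

Lemma frobN (R : realType) m n (A : 'M[R]_(m, n)) : frob (- A) = frob A.
Proof.
rewrite /frob; congr Num.sqrt; apply: eq_bigr => i _; apply: eq_bigr => j _.
by rewrite mxE sqrrN.
Qed.

Lemma frob_tr (R : realType) m n (A : 'M[R]_(m, n)) : frob A^T ^+ 2 = frob A ^+ 2.
Proof. by rewrite !frob_sqr trmxK mxtrace_mulC. Qed.

Lemma frob_sqrD (R : realType) m n (A B : 'M[R]_(m, n)) :
  frob (A + B) ^+ 2 = frob A ^+ 2 + frob B ^+ 2 + 2 * \tr (A^T *m B).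
Proof.
have trD : (A + B)^T = A^T + B^T by rewrite raddfD.
rewrite !frob_sqr trD.
rewrite mulmxDl !mulmxDr !mxtraceD.
have -> : \tr (B^T *m A) = \tr (A^T *m B) by rewrite -mxtrace_tr trmx_mul trmxK.
by ring.
Qed.

Lemma frob_isometryl (R : realType) m n p (Q : 'M[R]_(p, m)) (A : 'M[R]_(m, n)) :
  Q^T *m Q = 1%:M -> frob (Q *m A) ^+ 2 = frob A ^+ 2.
Proof. by move=> QQ; rewrite !frob_sqr trmx_mul mulmxA -(mulmxA _ Q^T) QQ mulmx1. Qed.

Lemma frob_isometryr (R : realType) m n p (Q : 'M[R]_(n, p)) (A : 'M[R]_(m, n)) :
  Q *m Q^T = 1%:M -> frob (A *m Q) ^+ 2 = frob A ^+ 2.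
Proof.
by move=> QQ; rewrite -frob_tr trmx_mul frob_isometryl ?frob_tr // trmxK.
Qed.

Lemma frob_row_mx (R : realType) m n p (A : 'M[R]_(m, n)) (B : 'M[R]_(m, p)) :
  frob (row_mx A B) ^+ 2 = frob A ^+ 2 + frob B ^+ 2.
Proof.
by rewrite -frob_tr frob_sqr trmxK tr_row_mx mul_row_col mxtraceD
  !(mxtrace_mulC _ _^T) -!frob_sqr.
Qed.

Lemma frob_diag_mx (R : realType) n (d : 'rV[R]_n) :
  frob (diag_mx d) ^+ 2 = \sum_i d 0 i ^+ 2.
Proof.
rewrite frob_sqr tr_diag_mx mulmx_diag mxtrace_diag.
by apply: eq_bigr => i _; rewrite mxE expr2.
Qed.

(** * Symmetric, skew-symmetric and positive semidefinite matrices *)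

Lemma symp_sym (R : realType) n (A : 'M[R]_n) : (symp A)^T = symp A.
Proof. by rewrite /symp linearZ /= raddfD /= trmxK addrC. Qed.

Lemma skewp_skew (R : realType) n (A : 'M[R]_n) : (skewp A)^T = - skewp A.
Proof. by rewrite /skewp linearZ /= raddfB /= trmxK -scalerN opprB. Qed.

Lemma sympN (R : realType) n (A : 'M[R]_n) : symp (- A) = - symp A.
Proof. by rewrite /symp raddfN -opprD scalerN. Qed.

(** Transposition and cyclicity show that the trace inner product of [A] and [B] is its own
    opposite. *)
Lemma frob_sym_skew (R : realType) n (A B : 'M[R]_n) : A^T = A -> B^T = - B ->
  frob (A + B) ^+ 2 = frob A ^+ 2 + frob B ^+ 2.
Proof.
move=> symA skewB; rewrite frob_sqrD.
have : \tr (A^T *m B) = - \tr (A^T *m B).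
  by rewrite -[LHS]mxtrace_tr trmx_mul trmxK skewB mulNmx raddfN /= mxtrace_mulC symA.
by move=> h; lra.
Qed.

Lemma psd_congr (R : realType) m n (B : 'M[R]_(n, m)) (A : 'M[R]_n) :
  psd A -> psd (B^T *m A *m B).
Proof.
move=> [symA A_ge0]; split; first by rewrite !trmx_mul trmxK symA mulmxA.
by move=> x; have := A_ge0 (B *m x); rewrite trmx_mul !mulmxA.
Qed.

Lemma psd_diag_ge0 (R : realType) n (A : 'M[R]_n) i : psd A -> 0 <= A i i.
Proof.
case=> _ /(_ (delta_mx i 0)).
by rewrite trmx_delta -rowE -colE !mxE.
Qed.

Lemma psd_diag_mx (R : realType) n (d : 'rV[R]_n) :
  (forall i, 0 <= d 0 i) -> psd (diag_mx d).
Proof.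
move=> d0; split=> [|x]; first exact: tr_diag_mx.
rewrite -{2}[x]trmxK mulmx_diag_trE sumr_ge0 // => k _.
by rewrite mulrAC -expr2 mulr_ge0 ?sqr_ge0.
Qed.

(** * Projection onto the positive semidefinite cone *)

Lemma psd_projP (R : realType) n (A : 'M[R]_n) : psd_part_of A (psd_proj A).
Proof.
have [p [q [z [Xi [lp [lm E]]]]]] := eigendecomposition_exists (symp_sym A).
have h : exists P, psd_part_of A P by eexists; exists p, q, z, Xi, lp, lm; split.
exact: (xgetPex 0 h).
Qed.

Lemma psd_proj_psd (R : realType) n (A : 'M[R]_n) : psd (psd_proj A).
Proof.
have [p [q [z [Xi [lp [lm [[_ lp_gt0 _ _] ->]]]]]]] := psd_projP A.
rewrite -{1}[Xi]trmxK; apply/psd_congr/psd_diag_mx => i.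
case: (split_ordP i) => {}i ->; first by rewrite row_mxEl ltW.
by case: (split_ordP i) => {}i ->; rewrite !(row_mxEl, row_mxEr) mxE.
Qed.

(** The positive block cancels and the negative one changes sign. This difference governs both the
    obtuse-angle inequality and the minimal value. *)
Lemma psd_projB (R : realType) n (A : 'M[R]_n) p q z
    (Xi : 'M[R]_(n, p + (q + z))) (lp : 'rV[R]_p) (lm : 'rV[R]_q) :
  A = Xi *m diag_mx (row_mx lp (row_mx lm 0)) *m Xi^T ->
  Xi *m diag_mx (row_mx lp (row_mx 0 0)) *m Xi^T - A =
    Xi *m diag_mx (row_mx 0 (row_mx (- lm) 0)) *m Xi^T.
Proof.
move=> ->; rewrite -mulmxBl -mulmxBr -raddfB /= !opp_row_mx !add_row_mx.
by rewrite subrr !subr0 sub0r.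
Qed.

Lemma mxtrace_diag_mul (R : pzSemiRingType) n (d : 'rV[R]_n) (A : 'M[R]_n) :
  \tr (diag_mx d *m A) = \sum_i d 0 i * A i i.
Proof. by apply: eq_bigr => i _; rewrite mul_diag_mx mxE. Qed.

(* The obtuse-angle inequality for the projection onto a closed convex cone. *)
Lemma psd_proj_obtuse (R : realType) n (A S : 'M[R]_n) : psd S ->
  frob (psd_proj A - symp A) ^+ 2 + frob (S - psd_proj A) ^+ 2
    <= frob (S - symp A) ^+ 2.
Proof.
move=> psdS; have -> : S - symp A = (psd_proj A - symp A) + (S - psd_proj A).
  by rewrite [RHS]addrC addrA subrK.
rewrite [X in _ <= X]frob_sqrD lerDl mulr_ge0 //.
(* It remains to bound the inner product of [psd_proj A - symp A] and [S - psd_proj A]. In the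
   eigenbasis only the negative block contributes; there the projection vanishes and each term is
   [- lm] times a diagonal entry of the psd matrix [Xi^T *m S *m Xi]. *)
have [p [q [z [Xi [lp [lm [[[XX _] _ lm_lt0 AE] PE]]]]]]] := psd_projP A.
rewrite {1}PE (psd_projB AE) !trmx_mul trmxK tr_diag_mx -!mulmxA mxtrace_mulC.
rewrite -!mulmxA mxtrace_diag_mul sumr_ge0 // => i _.
have -> : Xi^T *m ((S - psd_proj A) *m Xi) =
    Xi^T *m S *m Xi - diag_mx (row_mx lp (row_mx 0 0)).
  rewrite mulmxBl mulmxBr {1}PE !mulmxA XX mul1mx -!mulmxA XX mulmx1.
  by rewrite mulmxA.
have Y0 : 0 <= (Xi^T *m S *m Xi) i i by apply/psd_diag_ge0/psd_congr.
move: Y0; rewrite [X in _ * X]mxE; set Y := (_ *m _ *m _) i i; move: Y => Y Y0.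
rewrite [X in _ * (_ + X)]mxE [diag_mx _ i i]mxE eqxx mulr1n.
case: (split_ordP i) => j ->; first by rewrite !row_mxEl mxE mul0r.
rewrite !row_mxEr; case: (split_ordP j) => l ->.
  by rewrite !row_mxEl !mxE subr0 mulr_ge0 // oppr_ge0 ltW.
by rewrite !row_mxEr mxE mul0r.
Qed.

(** * Eigenvalues with multiplicity *)

Lemma prod_XsubC_perm (R : idomainType) (s t : seq R) :
  \prod_(a <- s) ('X - a%:P) = \prod_(a <- t) ('X - a%:P) -> perm_eq s t.
Proof.
elim: s t => [|a s IHs] t.
  case: t => // b t st; have := root_prod_XsubC (b :: t) b.
  by rewrite -st big_nil mem_head (negPf (root1 b)).
move=> st; have ta : a \in t by rewrite -root_prod_XsubC -st root_prod_XsubC mem_head.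
rewrite perm_sym (perm_trans (perm_to_rem ta)) // perm_cons perm_sym IHs //.
apply: (mulfI (negbT (polyXsubC_eq0 a))).
by move: st; rewrite (perm_big _ (perm_to_rem ta)) !big_cons.
Qed.

(** This makes the arbitrary choice in [eigenvalues] harmless: symmetric sums over it may be
    computed on any splitting of the characteristic polynomial. *)
Lemma perm_eigenvalues (R : realType) n (A : 'M[R]_n) s :
  char_poly A = \prod_(a <- s) ('X - a%:P) -> perm_eq (eigenvalues A) s.
Proof.
move=> charA; apply: prod_XsubC_perm; rewrite -charA; symmetry.
pose P : set (seq R) := [set s | char_poly A = \prod_(a <- s) ('X - a%:P)]%classic.
by apply: (@xgetPex _ [::] P); exists s.
Qed.

Lemma char_poly_orthogonal (R : realType) m n (Q : 'M[R]_(m, n)) (D : 'M[R]_n) :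
  orthogonal_mx Q -> char_poly (Q *m D *m Q^T) = char_poly D.
Proof.
case=> QQ QQ'; have mn : m = n.
  (* Each of the two identities bounds one dimension by the other. *)
  by apply/eqP; rewrite eqn_leq (mulmx1_min QQ) (mulmx1_min QQ').
case: n / mn Q D QQ QQ' => Q D QQ QQ'; rewrite /char_poly /char_poly_mx.
pose P := map_mx polyC Q.
have PP : P *m P^T = 1%:M by rewrite /P map_trmx -map_mxM QQ' map_mx1.
have -> : 'X%:M - map_mx polyC (Q *m D *m Q^T) =
    P *m ('X%:M - map_mx polyC D) *m P^T.
  by rewrite mulmxBr mulmxBl scalar_mxC -(mulmxA _ P) PP mulmx1 /P map_trmx -!map_mxM.
by rewrite !det_mulmx mulrAC -det_mulmx PP det1 mul1r.
Qed.

Lemma frob_Lambda_pos (R : realType) m n (A : 'M[R]_m) (Q : 'M[R]_(m, n)) (d : 'rV[R]_n) :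
  orthogonal_mx Q -> A = Q *m diag_mx d *m Q^T ->
  frob (Lambda_pos A) ^+ 2 = \sum_(i | 0 < d 0 i) d 0 i ^+ 2.
Proof.
move=> orthQ AE; pose s := [seq d 0 i | i <- enum 'I_n].
have /perm_eigenvalues es : char_poly A = \prod_(a <- s) ('X - a%:P).
  rewrite AE char_poly_orthogonal // char_poly_trig ?diag_mx_is_trig //.
  by rewrite big_map big_enum; apply: eq_bigr => i _; rewrite mxE eqxx.
rewrite frob_diag_mx; under eq_bigr do rewrite mxE.
rewrite -(big_mkord xpredT (fun i => (pos_eigenvalues A)`_i ^+ 2)).
rewrite -(big_nth 0 xpredT (fun x => x ^+ 2)) big_filter (perm_big _ es) big_map.
by rewrite big_enum_cond.
Qed.

(** Both squared norms are the sum of the squares of the negative eigenvalues of [symp A], which are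
    the positive ones of [- symp A] up to sign. *)
Lemma frob_psd_projB (R : realType) n (A : 'M[R]_n) :
  frob (psd_proj A - symp A) = frob (Lambda_pos (- symp A)).
Proof.
apply/eqP; rewrite -(eqrXn2 (ltn0Sn 1)) ?frob_ge0 //; apply/eqP.
have [p [q [z [Xi [lp [lm [[orthX lp_gt0 lm_lt0 AE] ->]]]]]]] := psd_projP A.
have [XX XX'] := orthX.
rewrite (frob_Lambda_pos (d := row_mx (- lp) (row_mx (- lm) 0)) orthX); last first.
  by rewrite -oppr0 -!opp_row_mx raddfN mulmxN mulNmx -AE.
rewrite (psd_projB AE) frob_isometryr ?trmxK // frob_isometryl // frob_diag_mx.
rewrite [RHS]big_mkcond !big_split_ord /=.
congr (_ + (_ + _)); apply: eq_bigr => i _.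
- by rewrite !row_mxEl !mxE oppr_gt0 ltNge ltW // expr0n.
- by rewrite !row_mxEr !row_mxEl mxE oppr_gt0 lm_lt0.
- by rewrite !row_mxEr mxE ltxx expr0n.
Qed.

(** * Compressions, the decoupled objective, and the minimisers *)

Lemma diag_mx_unit (F : fieldType) n (d : 'rV[F]_n) :
  (forall i, d 0 i != 0) -> diag_mx d \in unitmx.
Proof. by move=> d0; rewrite unitmxE det_diag unitfE; apply/prodf_neq0 => i _. Qed.

(* [A] minus its compression to the range of [V] is orthogonal to that
   compression. *)
Lemma frob_compression (R : realType) n r (V : 'M[R]_(n, r)) (A : 'M[R]_n) (K : 'M[R]_r) :
  V^T *m V = 1%:M -> V^T *m A *m V = K ->
  frob A ^+ 2 = frob (V *m K *m V^T) ^+ 2 + frob (A - V *m K *m V^T) ^+ 2.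
Proof.
move=> VV AK; rewrite -{1}[A](subrK (V *m K *m V^T)) [A - _ + _]addrC [LHS]frob_sqrD.
suff -> : \tr ((V *m K *m V^T)^T *m (A - V *m K *m V^T)) = 0 by rewrite mulr0 addr0.
rewrite !trmx_mul trmxK -!mulmxA mxtrace_mulC.
rewrite (_ : _ *m V = 0) ?mxtrace0 // -!mulmxA mulmxBl mulmxBr !mulmxA AK VV mul1mx.
by rewrite -!mulmxA VV mulmx1 subrr mulmx0.
Qed.

Lemma orthogonal_row_mx (R : realType) n p q (A : 'M[R]_(n, p)) (B : 'M[R]_(n, q)) :
  orthogonal_mx (row_mx A B) -> A^T *m A = 1%:M /\ A^T *m B = 0.
Proof.
case=> + _; rewrite tr_row_mx mul_col_row scalar_mx_block.
by case/eq_block_mx => -> ->.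
Qed.

Lemma objective_sqr (R : realType) (n M r k : nat) (T Z : 'M[R]_(n, M))
    (V : 'M[R]_(n, r)) (sigma : 'rV[R]_r) (W1 : 'M[R]_(M, r)) (W2 : 'M[R]_(M, k))
    (J S : 'M[R]_n) :
  let D := diag_mx sigma in
  T = V *m D *m W1^T -> orthogonal_mx (row_mx W1 W2) -> feasible J S ->
  objective T Z J S ^+ 2 =
    frob (D *m V^T *m Z *m W2) ^+ 2 +
    (frob (D *m V^T *m S *m V *m D - symp (- (D *m V^T *m Z *m W1))) ^+ 2 +
     frob (D *m V^T *m J *m V *m D - skewp (D *m V^T *m Z *m W1)) ^+ 2).
Proof.
move=> D TE orthW [skewJ [symS _]]; have [W11 W12] := orthogonal_row_mx orthW.
have trT : T^T = W1 *m D *m V^T by rewrite TE !trmx_mul trmxK tr_diag_mx mulmxA.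
have TW1 : T *m W1 = V *m D by rewrite TE -mulmxA W11 mulmx1.
have TW2 : T *m W2 = 0 by rewrite TE -mulmxA W12 mulmx0.
set Z1 := _ *m W1; set Z2 := _ *m W2.
have [_ WW] := orthW.
rewrite /objective -(frob_isometryr _ WW) mul_mx_row frob_row_mx addrC.
rewrite -[in RHS](frob_isometryl Z2 W11).
(* [T] annihilates [W2], so [J] and [S] disappear from this block. *)
have -> : T^T *m (Z - (J - S) *m T) *m W2 = W1 *m Z2.
  by rewrite -mulmxA mulmxBl -mulmxA TW2 mulmx0 subr0 trT !mulmxA.
congr (_ + _); set S' := _ *m D; set J' := _ *m D.
have -> : T^T *m (Z - (J - S) *m T) *m W1 =
    W1 *m ((S' - symp (- Z1)) + - (J' - skewp Z1)).
  (* The left side groups the symmetric and skew-symmetric parts of the right side. *)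
  have -> : S' - symp (- Z1) + - (J' - skewp Z1) = Z1 - (J' - S').
    by clearbody S' J' Z1; apply/matrixP => i j; rewrite !mxE; field.
  rewrite /Z1 /J' /S' -mulmxA mulmxBl -(mulmxA (J - S)) TW1 trT.
  rewrite !(mulmxBl, mulmxBr).
  by rewrite !mulmxA.
rewrite frob_isometryl // frob_sym_skew ?frobN //.
  by rewrite raddfB /= symp_sym /S' !trmx_mul trmxK tr_diag_mx symS !mulmxA.
have trJ : J^T = - J by rewrite [in RHS]skewJ opprK.
have trJ' : J'^T = - J'.
  by rewrite /J' !trmx_mul trmxK tr_diag_mx trJ !(mulmxN, mulNmx) !mulmxA.
by rewrite raddfN raddfB /= skewp_skew trJ' -opprD.
Qed.

Theorem theorem3p7 (R : realType) (n M k : nat) (T Z : 'M[R]_(n, M))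
    (V1 : 'M[R]_(n, \rank T)) (sigma : 'rV[R]_(\rank T))
    (W1 : 'M[R]_(M, \rank T)) (W2 : 'M[R]_(M, k))
    (svdT : skinny_svd V1 sigma W1)
    (orthW : orthogonal_mx (row_mx W1 W2)) :
  let Sigma1 := diag_mx sigma in
  let Z1 := Sigma1 *m V1^T *m Z *m W1 in
  let Z2 := Sigma1 *m V1^T *m Z *m W2 in
  let Jstar := V1 *m invmx Sigma1 *m skewp Z1 *m invmx Sigma1 *m V1^T in
  let Rstar := V1 *m invmx Sigma1 *m psd_proj (- Z1) *m invmx Sigma1 *m V1^T in
  [/\ min_norm_minimizer T Z Jstar Rstar,
      forall J S : 'M[R]_n,
        min_norm_minimizer T Z J S -> J = Jstar /\ S = Rstar &
      frob (T^T *m Z - T^T *m (Jstar - Rstar) *m T) ^+ 2 =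
        frob Z2 ^+ 2 + frob (Lambda_pos (symp Z1)) ^+ 2].
Proof.
case: svdT => V11 _ sigma_gt0 TE D Z1 Z2 Jstar Rstar.
rewrite /orthonormal_cols in V11.
have Du : D \in unitmx by apply: diag_mx_unit => i; rewrite gt_eqF.
have trDi : (invmx D)^T = invmx D by rewrite trmx_inv tr_diag_mx.
have objE := objective_sqr Z TE orthW.
(* Lifting [K] is a right inverse of the scaled compression, so any pair of target compressions is
   attained. *)
have compressK (K : 'M_(\rank T)) :
    D *m V1^T *m (V1 *m invmx D *m K *m invmx D *m V1^T) *m V1 *m D = K.
  rewrite !mulmxA -(mulmxA D) V11 mulmx1 mulmxV // mul1mx -(mulmxA _ V1^T) V11.
  by rewrite mulmx1 mulmxKV.
have compressP (A : 'M_n) (K : 'M_(\rank T)) :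
    D *m V1^T *m A *m V1 *m D = K ->
    frob A ^+ 2 = frob (V1 *m invmx D *m K *m invmx D *m V1^T) ^+ 2 +
      frob (A - V1 *m invmx D *m K *m invmx D *m V1^T) ^+ 2.
  move=> AK; have -> : V1 *m invmx D *m K *m invmx D *m V1^T =
      V1 *m (invmx D *m K *m invmx D) *m V1^T by rewrite !mulmxA.
  apply: frob_compression => //.
  by rewrite -AK !mulmxA mulVmx // mul1mx mulmxK.
have feas : feasible Jstar Rstar.
  split.
    by rewrite /Jstar !trmx_mul trmxK trDi skewp_skew !(mulNmx, mulmxN) opprK !mulmxA.
  have := psd_congr (invmx D *m V1^T) (psd_proj_psd (- Z1)).
  by rewrite trmx_mul trmxK trDi !mulmxA.
have obj_star : objective T Z Jstar Rstar ^+ 2 =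
    frob Z2 ^+ 2 + frob (Lambda_pos (symp Z1)) ^+ 2.
  rewrite objE // !compressK subrr frob0 expr0n addr0 -/Z1 frob_psd_projB.
  by rewrite sympN opprK.
(* The excess over the optimum dominates the squared distances of the compressions from their
   targets; this gives optimality and pins down all minimisers. *)
have obj_ge J S : feasible J S ->
    objective T Z Jstar Rstar ^+ 2 +
    (frob (D *m V1^T *m S *m V1 *m D - psd_proj (- Z1)) ^+ 2 +
     frob (D *m V1^T *m J *m V1 *m D - skewp Z1) ^+ 2) <= objective T Z J S ^+ 2.
  move=> feasJS; rewrite !objE // !compressK subrr frob0 expr0n addr0 -addrA.
  rewrite lerD2l addrA lerD2r; apply: psd_proj_obtuse.
  have := psd_congr (V1 *m D) feasJS.2.
  by rewrite trmx_mul tr_diag_mx !mulmxA.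
have minP J S : minimizer T Z J S ->
    D *m V1^T *m J *m V1 *m D = skewp Z1 /\
    D *m V1^T *m S *m V1 *m D = psd_proj (- Z1).
  case=> feasJS /(_ _ _ feas); rewrite /objective ler_frob => le_star.
  have := le_trans (obj_ge _ _ feasJS) le_star; rewrite gerDl.
  set a := frob _; set b := frob _ => ab.
  have a0 : a ^+ 2 = 0 by have := sqr_ge0 a; have := sqr_ge0 b; lra.
  have b0 : b ^+ 2 = 0 by have := sqr_ge0 a; have := sqr_ge0 b; lra.
  by split; apply/eqP; rewrite -subr_eq0; apply/eqP/frob_sqr_eq0.
have min_star : minimizer T Z Jstar Rstar.
  split=> // J S feasJS; rewrite /objective ler_frob.
  by apply: le_trans (obj_ge _ _ feasJS); rewrite lerDl addr_ge0 // sqr_ge0.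
split.
- split=> // J S /minP[/compressP JE /compressP SE].
  by rewrite !ler_frob JE SE !lerDl !sqr_ge0.
(* Comparison with the starred pair leaves no room for the second Pythagorean term, which measures
   the deviation from that pair. *)
- move=> J S [/minP[/compressP JE /compressP SE] /(_ _ _ min_star)].
  rewrite !ler_frob JE SE !gerDl => -[leJ leS].
  by split; apply/eqP; rewrite -subr_eq0; apply/eqP/frob_sqr_eq0/le_anti;
     rewrite sqr_ge0 andbT.
- by rewrite -obj_star /objective [in RHS]mulmxBr (mulmxA T^T).
Qed.
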